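(* Let $T$ be a 4-tangle (shadow diagram) with $\langle T\rangle=\sum_{i=1}^{14}a_i\langle g_i\rangle$, $a_i\in\mathbb{Z}[x]$, and for $n\ge 0$ write $\langle T_n\rangle=\sum_{i=1}^{14}a_i^{(n)}\langle g_i\rangle$ and $A_n=\big[a_1^{(n)},\dots,a_{14}^{(n)}\big]^\intercal$. Then for all $n\ge1$, $A_n=M A_{n-1}$, where $$M=\begin{pmatrix} a_{1}&0&0&0&0&0&0&0&0&0&0&0&0&0\\ a_{2}&u_{1}&0&0&0&u_{11}&0&0&0&0&0&0&0&u_{6}\\ a_{3}&0&u_{9}&0&u_{2}&0&0&u_{4}&0&0&0&0&0&0\\ a_{4}&0&0&u_{12}&0&0&u_{7}&0&0&0&0&0&u_{3}&0\\ a_{5}&0&u_{11}&0&u_{1}&0&0&u_{6}&0&0&0&0&0&0\\ a_{6}&u_{2}&0&0&0&u_{9}&0&0&0&0&0&0&0&u_{4}\\ a_{7}&0&0&u_{4}&0&0&u_{9}&0&0&0&0&0&u_{2}&0\\ a_{8}&0&u_{7}&0&u_{3}&0&0&u_{12}&0&0&0&0&0&0\\ a_{9}&0&u_{5}&0&u_{10}&0&0&u_{15}&u_{17}&u_{18}&0&0&0&0\\ a_{10}&0&u_{8}&0&u_{13}&0&0&u_{14}&u_{16}&u_{19}&0&0&0&0\\ a_{11}&u_{10}&0&u_{15}&0&u_{5}&u_{5}&0&0&0&u_{17}&u_{18}&u_{10}&u_{15}\\ a_{12}&u_{13}&0&u_{14}&0&u_{8}&u_{8}&0&0&0&u_{16}&u_{19}&u_{13}&u_{14}\\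 a_{13}&0&0&u_{6}&0&0&u_{11}&0&0&0&0&0&u_{1}&0\\ a_{14}&u_{3}&0&0&0&u_{7}&0&0&0&0&0&0&0&u_{12} \end{pmatrix}$$ with $u_1=a_1+a_5+a_2x$, $u_2=a_3+a_6x$, $u_3=a_8+a_{14}x$, $u_4=a_3+a_7x$, $u_5=a_{11}+a_9x$, $u_6=a_5+a_{13}x$, $u_7=a_{14}+a_4+a_8x$, $u_8=a_{12}+a_{10}x$, $u_9=a_1+a_6+a_7+a_3x$, $u_{10}=a_{13}+a_4+a_9+a_{11}x$, $u_{11}=a_{13}+a_2+a_5x$, $u_{12}=a_1+a_8+a_4x$, $u_{13}=a_{10}+a_7+a_{12}x$, $u_{14}=a_{10}+a_6+a_{12}x$, $u_{15}=a_{14}+a_2+a_9+a_{11}x$, $u_{16}=a_3+(a_{10}+a_6+a_7)x+a_{12}x^2$, $u_{17}=a_1+a_5+a_8+(a_{13}+a_{14}+a_2+a_4+a_9)x+a_{11}x^2$, $u_{18}=a_{13}+a_{14}+a_2+a_4+(a_{11}+a_5+a_8)x+a_9x^2$, $u_{19}=a_1+a_6+a_7+(a_{12}+a_3)x+a_{10}x^2$.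
   Context: A 4-tangle (shadow) is a planar diagram in a rectangle, made of finitely many arcs and closed curves immersed with only transverse double points (crossings, with no over/under information), having four endpoints $1,2,3,4$ on the top side and four endpoints $1',2',3',4'$ on the bottom side, both numbered from left to right. Bracket: $\langle\cdot\rangle$ is defined on shadow diagrams by (K1) $\langle\bigcirc\rangle=x$ for a single crossingless closed curve; (K2) $\langle\bigcirc\sqcup D'\rangle=x\langle D'\rangle$ for a disjoint crossingless closed curve; (K3) for any crossing of a diagram $D$, $\langle D\rangle=\langle D'\rangle+\langle D''\rangle$, where $D',D''$ are obtained from $D$ by replacing that crossing by its two planar smoothings. For a 4-tangle $T$, $\langle T\rangle$ is a unique $\mathbb{Z}[x]$-linear combination $\sum_{i=1}^{14}a_i\langle g_i\rangle$ in the free $\mathbb{Z}[x]$-module on the 14 crossingless, loop-free 4-tangles (up to planar isotopy) $g_1,\dots,g_{14}$, the basis of the Kauffman diagram monoid $\mathcal{K}_4$. These are the planar diagrams given by the following pairings of endpoints ($ij$ means endpoints $i$ and $j$ are joined): $g_1: 11',22',33',44'$; $g_2: 12,1'2',33',44'$; $g_3: 11',23,2'3',44'$; $g_4: 11',22',34,3'4'$; $g_5: 23,1'2',13',44'$; $g_6: 12,2'3',31',44'$; $g_7: 34,2'3',11',24'$; $g_8: 23,3'4',11',42'$; $g_9: 14,23,1'2',3'4'$; $g_{10}: 14,23,1'4',2'3'$; $g_{11}: 12,34,1'2',3'4'$; $g_{12}: 12,34,1'4',2'3'$; $g_{13}: 34,1'2',13',24'$; $g_{14}: 12,3'4',31',42'$.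 Concatenation: $TT'$ is the 4-tangle formed by placing $T$ directly above $T'$ and connecting the bottom endpoints of $T$ to the corresponding top endpoints of $T'$ by non-crossing planar arcs. For $n\ge1$, $T_n=TT\cdots T$ ($n$ copies), and $T_0=g_1$ (the identity tangle), so that $A_0=[1,0,\dots,0]^\intercal$. *)

(* Defs.v *)
From HB Require Import structures.
From mathcomp Require Import all_boot all_order all_algebra.
From mathcomp.multinomials Require Import monalg.
From mathcomp Require Import zify.

Set Implicit Arguments.
Unset Strict Implicit.
Unset Printing Implicit Defensive.

Import GRing.Theory.
Local Open Scope ring_scope.

(* A shadow diagram is put in general position with respect to the height     *)
(* function and cut into horizontal slices, listed from top to bottom, each   *)
(* containing exactly one event; strands are numbered from 0, left to right:  *)
(*    Cup i   : strands i and i+1 are joined (local minimum of a curve);      *)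
(*    Cap i   : two new strands i and i+1 are born (local maximum);           *)
(*    Cross i : strands i and i+1 cross transversally.                        *)
(* Every shadow diagram is planar isotopic to such a stack of slices.         *)
Inductive slice := Cup of nat | Cap of nat | Cross of nat.

Fixpoint well_formed (m n : nat) (w : seq slice) : bool :=
  match w with
  | [::] => m == n
  | Cup i :: w' => (i.+1 < m)%N && well_formed (m - 2) n w'
  | Cap i :: w' => (i <= m)%N && well_formed m.+2 n w'
  | Cross i :: w' => (i.+1 < m)%N && well_formed m n w'
  end.

Record tangle4 := Tangle4 {
  slices :> seq slice;
  slicesP : well_formed 4 4 slices }.

Lemma well_formed_cat (m n p : nat) (w w' : seq slice) :
  well_formed m n w -> well_formed n p w' -> well_formed m p (w ++ w').
Proof.
elim: w m => [|[i|i|i] w IHw] m /= => [/eqP-> // | | | ] /andP[-> wfw] wfw' /=;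
  exact: IHw.
Qed.

Definition concat (T T' : tangle4) : tangle4 :=
  Tangle4 (well_formed_cat (slicesP T) (slicesP T')).

Definition id_tangle : tangle4 := @Tangle4 [::] isT.

Definition tangle_pow (T : tangle4) (n : nat) : tangle4 :=
  iter n (concat T) id_tangle.

Definition endpoint : finType := ('I_4 + 'I_4)%type.

(* The endpoints k and k', for 1 <= k <= 4. *)
Definition top (k : nat) : endpoint := inl (inord k.-1).
Definition bot (k : nat) : endpoint := inr (inord k.-1).

(* A crossingless loop-free 4-tangle, up to planar isotopy, is the set of     *)
(* pairs of endpoints that it joins.                                          *)
Definition pairing := {set {set endpoint}}.

Definition g_table : seq (seq (endpoint * endpoint)) :=
  let: (t1, t2, t3, t4) := (top 1, top 2, top 3, top 4) in
  let: (b1, b2, b3, b4) := (bot 1, bot 2, bot 3, bot 4) in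
  [:: [:: (t1, b1); (t2, b2); (t3, b3); (t4, b4)];
      [:: (t1, t2); (b1, b2); (t3, b3); (t4, b4)];
      [:: (t1, b1); (t2, t3); (b2, b3); (t4, b4)];
      [:: (t1, b1); (t2, b2); (t3, t4); (b3, b4)];
      [:: (t2, t3); (b1, b2); (t1, b3); (t4, b4)];
      [:: (t1, t2); (b2, b3); (t3, b1); (t4, b4)];
      [:: (t3, t4); (b2, b3); (t1, b1); (t2, b4)];
      [:: (t2, t3); (b3, b4); (t1, b1); (t4, b2)];
      [:: (t1, t4); (t2, t3); (b1, b2); (b3, b4)];
      [:: (t1, t4); (t2, t3); (b1, b4); (b2, b3)];
      [:: (t1, t2); (t3, t4); (b1, b2); (b3, b4)];
      [:: (t1, t2); (t3, t4); (b1, b4); (b2, b3)];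
      [:: (t3, t4); (b1, b2); (t1, b3); (t2, b4)];
      [:: (t1, t2); (b3, b4); (t3, b1); (t4, b2)]].

Definition pairing_of (l : seq (endpoint * endpoint)) : pairing :=
  [set [set p.1; p.2] | p in l].

(* g i is the diagram traditionally numbered i.+1. *)
Definition g (i : 'I_14) : pairing := pairing_of (nth [::] g_table i).

(* Connectivity of the part of a crossingless diagram lying above a           *)
(* horizontal line: each arc or closed curve met so far has a label, tops and *)
(* bots list the labels at the four top endpoints and at the points of the    *)
(* line, and loops counts the closed curves lying entirely above the line.    *)
Record trace := Trace { tops : seq nat; bots : seq nat; loops : nat }.

(* A cup joins two arcs, unless its two ends carry the same label: they are   *)
(* then the two ends of a single arc, which becomes a closed curve.           *)
Definition cup_trace (i : nat) (t : trace) : trace :=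
  let p := nth 0%N (bots t) i in
  let q := nth 0%N (bots t) i.+1 in
  let bots' := take i (bots t) ++ drop i.+2 (bots t) in
  let merge := map (fun r => if r == q then p else r) in
  if p == q then Trace (tops t) bots' (loops t).+1
  else Trace (merge (tops t)) (merge bots') (loops t).

Definition fresh (t : trace) : nat := (\max_(p <- tops t ++ bots t) p).+1.

Definition cap_trace (i : nat) (t : trace) : trace :=
  Trace (tops t)
    (take i (bots t) ++ [:: fresh t; fresh t] ++ drop i (bots t)) (loops t).

Definition label (t : trace) (e : endpoint) : nat :=
  match e with
  | inl i => nth 0%N (tops t) i
  | inr i => nth 0%N (bots t) i
  end.

Definition trace_pairing (t : trace) : pairing :=
  preim_partition (label t) [set: endpoint].

(* A crossing of strands i and i+1 has two planar smoothings: the two         *)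
(* vertical strands (an empty slice), and a cup followed by a cap.  A         *)
(* crossingless diagram with l closed curves has bracket 'X^l times the       *)
(* basis element given by its pairing of the endpoints.                       *)
Fixpoint bracket_from (t : trace) (w : seq slice) :
    {malg {poly int}[pairing]} :=
  match w with
  | [::] => 'X^(loops t) *: << trace_pairing t >>
  | Cup i :: w' => bracket_from (cup_trace i t) w'
  | Cap i :: w' => bracket_from (cap_trace i t) w'
  | Cross i :: w' =>
      bracket_from t w' + bracket_from (cap_trace i (cup_trace i t)) w'
  end.

Definition init_trace : trace := Trace (iota 0 4) (iota 0 4) 0.

Definition bracket (T : tangle4) : {malg {poly int}[pairing]} :=
  bracket_from init_trace T.

Definition transfer_rows (a : nat -> {poly int}) : seq (seq {poly int}) :=
  let a1 := a 1%N in let a2 := a 2%N in let a3 := a 3%N in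
  let a4 := a 4%N in let a5 := a 5%N in let a6 := a 6%N in
  let a7 := a 7%N in let a8 := a 8%N in let a9 := a 9%N in
  let a10 := a 10%N in let a11 := a 11%N in let a12 := a 12%N in
  let a13 := a 13%N in let a14 := a 14%N in
  let x : {poly int} := 'X in
  let u1 := a1 + a5 + a2 * x in
  let u2 := a3 + a6 * x in
  let u3 := a8 + a14 * x in
  let u4 := a3 + a7 * x in
  let u5 := a11 + a9 * x in
  let u6 := a5 + a13 * x in
  let u7 := a14 + a4 + a8 * x in
  let u8 := a12 + a10 * x in
  let u9 := a1 + a6 + a7 + a3 * x in
  let u10 := a13 + a4 + a9 + a11 * x in
  let u11 := a13 + a2 + a5 * x in
  let u12 := a1 + a8 + a4 * x in
  let u13 := a10 + a7 + a12 * x in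
  let u14 := a10 + a6 + a12 * x in
  let u15 := a14 + a2 + a9 + a11 * x in
  let u16 := a3 + (a10 + a6 + a7) * x + a12 * x ^+ 2 in
  let u17 := a1 + a5 + a8 + (a13 + a14 + a2 + a4 + a9) * x + a11 * x ^+ 2 in
  let u18 := a13 + a14 + a2 + a4 + (a11 + a5 + a8) * x + a9 * x ^+ 2 in
  let u19 := a1 + a6 + a7 + (a12 + a3) * x + a10 * x ^+ 2 in
  [::
      [:: a1; 0; 0; 0; 0; 0; 0; 0; 0; 0; 0; 0; 0; 0];
      [:: a2; u1; 0; 0; 0; u11; 0; 0; 0; 0; 0; 0; 0; u6];
      [:: a3; 0; u9; 0; u2; 0; 0; u4; 0; 0; 0; 0; 0; 0];
      [:: a4; 0; 0; u12; 0; 0; u7; 0; 0; 0; 0; 0; u3; 0];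
      [:: a5; 0; u11; 0; u1; 0; 0; u6; 0; 0; 0; 0; 0; 0];
      [:: a6; u2; 0; 0; 0; u9; 0; 0; 0; 0; 0; 0; 0; u4];
      [:: a7; 0; 0; u4; 0; 0; u9; 0; 0; 0; 0; 0; u2; 0];
      [:: a8; 0; u7; 0; u3; 0; 0; u12; 0; 0; 0; 0; 0; 0];
      [:: a9; 0; u5; 0; u10; 0; 0; u15; u17; u18; 0; 0; 0; 0];
      [:: a10; 0; u8; 0; u13; 0; 0; u14; u16; u19; 0; 0; 0; 0];
      [:: a11; u10; 0; u15; 0; u5; u5; 0; 0; 0; u17; u18; u10; u15];
      [:: a12; u13; 0; u14; 0; u8; u8; 0; 0; 0; u16; u19; u13; u14];
      [:: a13; 0; 0; u6; 0; 0; u11; 0; 0; 0; 0; 0; u1; 0];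
      [:: a14; u3; 0; 0; 0; u7; 0; 0; 0; 0; 0; 0; 0; u12] ].

(* The argument holds the coefficients a 1, ..., a 14 in rows 0, ..., 13.     *)
Definition transfer_matrix (A : 'cV[{poly int}]_14) : 'M[{poly int}]_14 :=
  let rows := transfer_rows (fun k => A (inord k.-1) 0) in
  \matrix_(i < 14, j < 14) nth 0 (nth [::] rows i) j.

Lemma bracket_crossing (T T' T'' : tangle4) (u v : seq slice) (i : nat) :
  slices T = u ++ Cross i :: v ->
  slices T' = u ++ v -> slices T'' = u ++ Cup i :: Cap i :: v ->
  bracket T = bracket T' + bracket T''.
Proof.
rewrite /bracket => -> -> ->.
elim: u init_trace => [|[j|j|j] u IHu] t //=.
by rewrite !IHu addrACA.
Qed.

Lemma bracket_from_loop (t : trace) (w : seq slice) :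
  bracket_from (Trace (tops t) (bots t) (loops t).+1) w =
  'X *: bracket_from t w.
Proof.
elim: w t => [|[i|i|i] w IHw] t /=; first by rewrite exprS scalerA.
- rewrite -IHw /cup_trace /=; congr (bracket_from _ w).
  by case: ifP.
- exact: (IHw (cap_trace i t)).
- rewrite scalerDr -!IHw; congr (_ + bracket_from _ w).
  by rewrite /cup_trace /=; case: ifP.
Qed.

Lemma size_cup (i : nat) (t : trace) :
  (i.+1 < size (bots t))%N ->
  size (bots (cup_trace i t)) = (size (bots t) - 2)%N.
Proof.
move=> lti; rewrite /cup_trace; case: ifP => _;
  rewrite /= ?size_map size_cat size_drop size_takel; lia.
Qed.

Lemma size_cap (i : nat) (t : trace) :
  (i <= size (bots t))%N ->
  size (bots (cap_trace i t)) = (size (bots t)).+2.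
Proof. by move=> lei; rewrite /= size_cat /= size_drop size_takel; lia. Qed.

Lemma cap_cup (i : nat) (t : trace) :
  (i <= size (bots t))%N ->
  cup_trace i (cap_trace i t) = Trace (tops t) (bots t) (loops t).+1.
Proof.
move=> lei; have szi : size (take i (bots t)) = i by exact: size_takel.
have e1 : (i.+1 - i = 1)%N by lia.
have e2 : (i.+2 - i = 2)%N by lia.
have lt1 : (i.+1 < i)%N = false by lia.
have lt2 : (i.+2 < i)%N = false by lia.
rewrite /cup_trace /= !nth_cat szi ltnn lt1 e1 subnn /= eqxx.
by rewrite take_cat drop_cat szi ltnn lt2 subnn e2 /= cats0 drop0 cat_take_drop.
Qed.

Lemma bracket_loop (T T' : tangle4) (u v : seq slice) (i : nat) :
  slices T = u ++ Cap i :: Cup i :: v -> slices T' = u ++ v ->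
  bracket T = 'X *: bracket T'.
Proof.
move=> eT eT'; have := slicesP T; rewrite /bracket eT eT' {eT eT'}.
have : size (bots init_trace) = 4%N by [].
elim: u init_trace {1 2}4%N => [|[j|j|j] u IHu] t m /= szt /andP[ltj wfu].
- by rewrite cap_cup ?szt // bracket_from_loop.
- by apply: IHu wfu; rewrite size_cup szt.
- by apply: IHu wfu; rewrite size_cap szt.
- have szc : size (bots (cap_trace j (cup_trace j t))) = m.
    by rewrite size_cap size_cup szt; lia.
  by rewrite scalerDr (IHu _ _ szt wfu) (IHu _ _ szc wfu).
Qed.

Inductive noncrossing : seq nat -> Prop :=
| noncrossing_nil : noncrossing [::]
| noncrossing_ins u v p of p \notin u ++ v & noncrossing (u ++ v) :
    noncrossing (u ++ p :: p :: v).

Lemma noncrossing_map (f : nat -> nat) (s : seq nat) :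
  {in s &, injective f} -> noncrossing s -> noncrossing (map f s).
Proof.
move=> injf ncs; elim: ncs injf => [|u v p pNuv _ IH] injf //=.
  exact: noncrossing_nil.
have sub x : x \in u ++ v -> x \in u ++ p :: p :: v.
  by rewrite !mem_cat !inE => /orP[->|->] //; rewrite !orbT.
have pin : p \in u ++ p :: p :: v by rewrite mem_cat !inE eqxx orbT.
rewrite map_cat /=; apply: noncrossing_ins; rewrite -map_cat.
  apply/mapP=> -[x xuv /injf epx]; move: pNuv.
  by rewrite epx ?xuv // sub.
by apply: IH => x y xuv yuv; apply: injf; apply: sub.
Qed.

Lemma cat_split (u v u' v' : seq nat) :
  u ++ v = u' ++ v' -> (size u <= size u')%N ->
  exists2 w, u' = u ++ w & v = w ++ v'.
Proof.
elim: u u' => [|x u IHu] [|x' u'] //= e le; first by exists [::].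
  by exists (x' :: u').
by case: e => -> /IHu /(_ le)[w -> ->]; exists w.
Qed.

Lemma noncrossing_join (u v : seq nat) (p q : nat) :
  noncrossing (u ++ p :: q :: v) ->
  noncrossing (map (fun r => if r == q then p else r) (u ++ v)).
Proof.
move: {-2}(u ++ _) (erefl (u ++ p :: q :: v)) => s es ncs.
elim: ncs u v es => [u v|u' v' x xNuv ncuv IH u v es].
  by move/(congr1 size); rewrite size_cat /= addnS.
set f := fun r => _.
have fN w : x \notin w -> x != p -> x \notin map f w.
  move=> xNw xp; apply/mapP=> -[y yw]; rewrite /f; case: eqP => _ exy.
    by rewrite exy eqxx in xp.
  by rewrite exy yw in xNw.
have fid w : q \notin w -> map f w = w.
  move=> qNw; rewrite -[RHS]map_id; apply/eq_in_map => y yw; rewrite /f.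
  by case: eqP yw qNw => // -> ->.
case: (leqP (size u) (size u')) => [le|/ltnW le].
  have [[|a [|b w]] eu ev] := cat_split (esym es) le.
  - case: ev => ep eq ev; rewrite cats0 in eu; subst u' x q v'.
    rewrite /f (eq_map (g := id)) ?map_id // => y; case: eqP => // ->.
  - case: ev => ea eq ev; subst a x u' v.
    move: xNuv; rewrite -catA mem_cat inE !negb_or => /and3P[qu qp qv].
    by rewrite map_cat /= (fid u) // (fid v') // /f eqxx; rewrite -catA in ncuv.
  - case: ev => ea eb ev; subst a b u' v.
    move: xNuv; rewrite -catA /= mem_cat !inE mem_cat !negb_or.
    move=> /and5P[xu xp xq xw xv].
    have := IH u (w ++ v'); rewrite -catA /= => /(_ erefl).
    rewrite catA !map_cat /= [f x]/f (negbTE xq) => nc.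
    rewrite catA; apply: noncrossing_ins; last by [].
    rewrite -!map_cat; apply: fN; last by [].
    by rewrite !mem_cat !negb_or xu xw.
have [[|a [|b w]] eu ev] := cat_split es le.
- case: ev => ep eq ev; rewrite cats0 in eu; subst u p q v'.
  rewrite /f (eq_map (g := id)) ?map_id // => y; case: eqP => // ->.
- case: ev => ea eq ev; subst a p u v'.
  move: xNuv; rewrite mem_cat inE !negb_or => /and3P[xu xq xv].
  have -> : map f ((u' ++ [:: x]) ++ v) = map f (u' ++ q :: v).
    by rewrite -catA !map_cat /= /f eqxx (negbTE xq).
  apply: noncrossing_map ncuv => y z; rewrite /f.
  have xN y' : y' \in u' ++ q :: v -> x != y'.
    by apply: contraTneq => <-; rewrite mem_cat inE !negb_or xu xq.
  move=> /xN xy /xN xz; case: (y =P q) => [->|_]; case: (z =P q) => [->|_] //.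
    by move=> e; rewrite e eqxx in xz.
  by move=> e; rewrite e eqxx in xy.
- case: ev => ea eb ev; subst a b u v'.
  move: xNuv; rewrite !mem_cat !inE !negb_or => /and5P[xu xw xp xq xv].
  have := IH (u' ++ w) v (catA _ _ _).
  rewrite -!catA !map_cat /= [f x]/f (negbTE xq) => nc.
  apply: noncrossing_ins; last by [].
  rewrite -!map_cat; apply: fN; first by rewrite !mem_cat !negb_or xu xw.
  exact: xp.
Qed.

Definition trace_word (t : trace) : seq nat := rev (tops t) ++ bots t.

Lemma noncrossing_cup (i : nat) (t : trace) :
  (i.+1 < size (bots t))%N ->
  noncrossing (trace_word t) -> noncrossing (trace_word (cup_trace i t)).
Proof.
move=> lti; rewrite /trace_word.
rewrite -{1}(cat_take_drop i (bots t)) (drop_nth 0%N (ltnW lti)).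
rewrite (drop_nth 0%N lti) catA => /noncrossing_join.
rewrite /cup_trace; case: eqP => [->|_] /=.
  by rewrite -catA (eq_map (g := id)) ?map_id // => y; case: eqP => // ->.
by rewrite -map_rev -map_cat catA.
Qed.

Lemma noncrossing_cap (i : nat) (t : trace) :
  noncrossing (trace_word t) -> noncrossing (trace_word (cap_trace i t)).
Proof.
rewrite /trace_word /= -{1}(cat_take_drop i (bots t)) catA => nc.
rewrite catA; apply: noncrossing_ins nc; rewrite -catA cat_take_drop.
apply/negP; rewrite mem_cat mem_rev -mem_cat => ft.
by have := @leq_bigmax_seq _ _ predT id _ ft isT; rewrite ltnn.
Qed.

(* The noncrossing words up to renaming: each letter is replaced by the       *)
(* position of its first occurrence.                                          *)
Definition canonical (s : seq nat) : seq nat := [seq index p s | p <- s].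

Definition insert_pair (m : nat) (c : seq nat) : seq nat :=
  let c' := [seq if (k < m)%N then k else k.+2 | k <- c] in
  take m c' ++ m :: m :: drop m c'.

Fixpoint noncrossing_words (n : nat) : seq (seq nat) :=
  if n is n'.+1 then
    flatten [seq [seq insert_pair m c | m <- iota 0 n'.*2.+1]
            | c <- noncrossing_words n']
  else [:: [::]].

Lemma canonical_ins (u v : seq nat) (p : nat) :
  p \notin u ++ v ->
  canonical (u ++ p :: p :: v) = insert_pair (size u) (canonical (u ++ v)).
Proof.
rewrite mem_cat negb_or => /andP[pu pv].
pose h q := index q (u ++ p :: p :: v).
have -> : canonical (u ++ p :: p :: v) = map h u ++ size u :: size u :: map h v.
  rewrite /canonical map_cat /= -/(h p).
  by rewrite /h index_cat (negbTE pu) /= eqxx addn0.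
suff eh : [seq if (k < size u)%N then k else k.+2 | k <- canonical (u ++ v)] =
    map h u ++ map h v.
  by rewrite /insert_pair eh take_size_cat ?drop_size_cat ?size_map.
rewrite -map_cat -map_comp; apply/eq_in_map => q quv /=; rewrite /h !index_cat.
case: (boolP (q \in u)) quv => [qu _|qu]; first by rewrite index_mem qu.
rewrite mem_cat (negbTE qu) /= ltnNge leq_addr /= => qv.
by case: eqP => [epq|_]; [rewrite epq qv in pv | rewrite !addnS].
Qed.

Lemma canonical_noncrossing (n : nat) (s : seq nat) :
  noncrossing s -> size s = n.*2 -> canonical s \in noncrossing_words n.
Proof.
move=> ncs; elim: ncs n => [|u v p pNuv _ IH] [|n] //.
  by rewrite size_cat /= addnS.
rewrite size_cat /= !addnS doubleS => -[szuv]; rewrite canonical_ins //.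
apply/flatten_mapP; exists (canonical (u ++ v)).
  by apply: IH; rewrite size_cat.
rewrite -[_ :: _]/(map (insert_pair^~ _) (iota 0 n.*2.+1)).
by apply/mapP; exists (size u) => //; rewrite mem_iota /= add0n ltnS -szuv leq_addr.
Qed.

Lemma canonical_eq (s : seq nat) (i j : nat) :
  (i < size s)%N -> (j < size s)%N ->
  (nth 0%N (canonical s) i == nth 0%N (canonical s) j) =
  (nth 0%N s i == nth 0%N s j).
Proof.
move=> lti ltj; rewrite !(nth_map 0%N) //; apply/eqP/eqP => [|-> //].
by move/(congr1 (nth 0%N s)); rewrite !nth_index ?mem_nth.
Qed.

(* Position of an endpoint in the word of a trace of a 4-tangle.              *)
Definition position (e : endpoint) : nat :=
  match e with inl i => (3 - i)%N | inr i => (4 + i)%N end.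

Lemma position_lt (e : endpoint) : (position e < 8)%N.
Proof. by case: e => -[i lti] /=; lia. Qed.

Lemma position_inj : injective position.
Proof.
by case=> -[i lti] [] [j ltj] /= e; try lia; congr (_ _); apply: val_inj => /=;
  lia.
Qed.

Lemma label_position (t : trace) (e : endpoint) :
  size (tops t) = 4%N -> label t e = nth 0%N (trace_word t) (position e).
Proof.
move=> szt; rewrite /trace_word nth_cat size_rev szt; case: e => -[i lti] /=.
  case: ltnP => [_|]; last by lia.
  by rewrite nth_rev szt; [congr nth; lia | lia].
by rewrite -/(addn 4 i) ?addKn.
Qed.

Definition position2 (p : endpoint * endpoint) : nat * nat :=
  (position p.1, position p.2).

Definition g_positions : seq (seq (nat * nat)) :=
  [:: [:: (3, 4); (2, 5); (1, 6); (0, 7)];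
      [:: (3, 2); (4, 5); (1, 6); (0, 7)];
      [:: (3, 4); (2, 1); (5, 6); (0, 7)];
      [:: (3, 4); (2, 5); (1, 0); (6, 7)];
      [:: (2, 1); (4, 5); (3, 6); (0, 7)];
      [:: (3, 2); (5, 6); (1, 4); (0, 7)];
      [:: (1, 0); (5, 6); (3, 4); (2, 7)];
      [:: (2, 1); (6, 7); (3, 4); (0, 5)];
      [:: (3, 0); (2, 1); (4, 5); (6, 7)];
      [:: (3, 0); (2, 1); (4, 7); (5, 6)];
      [:: (3, 2); (1, 0); (4, 5); (6, 7)];
      [:: (3, 2); (1, 0); (4, 7); (5, 6)];
      [:: (1, 0); (4, 5); (3, 6); (2, 7)];
      [:: (3, 2); (6, 7); (1, 4); (0, 5)]]%N.

Lemma g_positionsE : map (map position2) g_table = g_positions.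
Proof. by rewrite /= /position2 /= !inordK. Qed.

Definition matches (c : seq nat) (l : seq (nat * nat)) : bool :=
  [&& all (fun p => nth 0%N c p.1 == nth 0%N c p.2) l,
      all (fun p => all (fun q =>
        (nth 0%N c p.1 == nth 0%N c q.1) ==> (p == q)) l) l &
      all (fun i => has (fun p => (p.1 == i) || (p.2 == i)) l) (iota 0 8)].

Lemma noncrossing_words4 :
  all (fun c => has (fun i => matches c (nth [::] g_positions i)) (iota 0 14))
      (noncrossing_words 4).
Proof. by vm_compute. Qed.

Lemma trace_pairing_g (t : trace) :
  size (tops t) = 4%N -> size (bots t) = 4%N -> noncrossing (trace_word t) ->
  exists i : 'I_14, trace_pairing t = g i.
Proof.
move=> szt szb nct.
have szw : size (trace_word t) = 8%N by rewrite size_cat size_rev szt szb.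
have /(allP noncrossing_words4) /hasP[i] := canonical_noncrossing (n := 4) nct szw.
rewrite mem_iota /= add0n => lti; set c := canonical _.
rewrite -g_positionsE (nth_map [::]) //; set l := nth _ _ _.
have labE e f : (nth 0%N c (position e) == nth 0%N c (position f)) =
    (label t e == label t f).
  by rewrite canonical_eq ?szw ?position_lt // !label_position.
case/and3P; rewrite all_map => /allP eql /allP uniql /allP covl.
exists (Ordinal lti); rewrite /g /pairing_of -/l.
have eql' p : p \in l -> label t p.1 = label t p.2.
  by move/eql => /=; rewrite labE => /eqP.
have uniql' p q : p \in l -> q \in l -> label t p.1 = label t q.1 -> p = q.
  move=> pl ql /eqP epq.
  have /allP /(_ _ (map_f _ ql)) := uniql _ (map_f position2 pl).
  rewrite /= labE epq /= => /eqP[/position_inj e1 /position_inj e2].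
  by move: e1 e2; case: (p) (q) => [? ?] [? ?] /= -> ->.
have covl' e : exists2 p, p \in l & (p.1 == e) || (p.2 == e).
  have := covl (position e); rewrite mem_iota /= position_lt => /(_ isT).
  rewrite has_map => /hasP[p pl] /=; rewrite !(inj_eq position_inj).
  by exists p.
have blockE p : p \in l ->
    [set y in [set: endpoint] | label t p.1 == label t y] = [set p.1; p.2].
  move=> pl; apply/setP => y; rewrite !inE; apply/eqP/orP.
    move=> epy; have [q ql qy] := covl' y.
    have epq : p = q.
      by apply: uniql' => //; case/orP: qy => /eqP ey; rewrite epy -ey ?eql'.
    by rewrite epq; case/orP: qy => /eqP ->; rewrite eqxx; [left|right].
  by case=> /eqP -> //; apply: eql'.
apply/setP => B; apply/imsetP/imsetP => [[e _ ->]|[p pl ->]].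
  have [p pl pe] := covl' e; exists p => //.
  rewrite -(blockE _ pl); apply/setP => y; rewrite !inE.
  by case/orP: pe => /eqP <-; rewrite ?(eql' _ pl).
by exists p.1; rewrite ?inE // -(blockE _ pl).
Qed.

Lemma g_inj : injective g.
Proof.
have in2 x y a b : [set x; y] = [set a; b] :> {set endpoint} ->
    (x, y) = (a, b) \/ (x, y) = (b, a).
  move=> exy; have := set21 x y; have := set22 x y; rewrite exy.
  have := set21 a b; have := set22 a b; rewrite -{1 2}exy.
  by move=> /set2P[]eb /set2P[]ea /set2P[]ey /set2P[]ex; subst; auto.
have pin i j : g i = g j -> all (fun p =>
    (p \in nth [::] g_positions j) || ((p.2, p.1) \in nth [::] g_positions j))
    (nth [::] g_positions i).
  move=> eij; rewrite -g_positionsE !(nth_map [::]) // all_map; apply/allP.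
  move=> [x y] xyi; have : [set x; y] \in g i by apply/imsetP; exists (x, y).
  rewrite eij => /imsetP[[a b] abj] /in2 [] -[-> ->] /=; apply/orP.
    by left; apply: (map_f position2 abj).
  by right; apply: (map_f position2 abj).
move=> i j /pin pij; apply/val_inj/eqP; move: pij.
have : all (fun i => all (fun j => all (fun p =>
    (p \in nth [::] g_positions j) || ((p.2, p.1) \in nth [::] g_positions j))
    (nth [::] g_positions i) ==> (i == j)) (iota 0 14)) (iota 0 14).
  by vm_compute.
move=> /allP /(_ i) ; rewrite mem_iota ltn_ord => /(_ isT) /allP /(_ j).
by rewrite mem_iota ltn_ord => /(_ isT) /implyP.
Qed.

Lemma bracket_from_expansion (t : trace) (w : seq slice) :
  size (tops t) = 4%N -> well_formed (size (bots t)) 4 w ->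
  noncrossing (trace_word t) ->
  exists a : 'cV[{poly int}]_14,
    bracket_from t w = \sum_(i < 14) a i 0 *: << g i >>.
Proof.
have szc i t' : size (tops (cup_trace i t')) = size (tops t').
  by rewrite /cup_trace; case: ifP; rewrite //= size_map.
elim: w t => [|[i|i|i] w IHw] t /= szt.
- move=> /eqP szb /(trace_pairing_g szt szb)[i ->].
  exists (\col_j (if j == i then 'X^(loops t) else 0)).
  rewrite (bigD1 i) //= big1 => [|j /negbTE ji]; rewrite mxE ?ji ?scale0r //.
  by rewrite eqxx addr0.
- move=> /andP[lti wfw] nct.
  by apply: IHw; rewrite ?szc ?size_cup //; apply: noncrossing_cup.
- move=> /andP[lei wfw] nct.
  by apply: IHw; rewrite ?size_cap //; apply: noncrossing_cap.
- move=> /andP[lti wfw] nct; have [a ->] := IHw t szt wfw nct.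
  case: (IHw (cap_trace i (cup_trace i t))).
  + by rewrite /= szc.
  + by rewrite size_cap size_cup //; [have -> : (size (bots t) - 2).+2 =
      size (bots t) by lia | lia].
  + exact/noncrossing_cap/noncrossing_cup.
  move=> b ->; exists (a + b); rewrite -big_split /=.
  by apply: eq_bigr => j _; rewrite mxE scalerDl.
Qed.

Lemma bracket_expansion (T : tangle4) :
  exists! a : 'cV[{poly int}]_14,
    bracket T = \sum_(i < 14) a i 0 *: << g i >>.
Proof.
have [||a ea] := @bracket_from_expansion init_trace T erefl; first exact: slicesP.
  apply: (@noncrossing_ins [:: 3; 2; 1]%N) => //.
  apply: (@noncrossing_ins [:: 3; 2]%N) => //.
  apply: (@noncrossing_ins [:: 3]%N) => //.
  exact: (@noncrossing_ins [::] [::] 3 _ noncrossing_nil).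
exists a; split=> // b; rewrite /bracket ea => eab; apply/colP => i.
have coefE (c : 'cV[{poly int}]_14) :
    (\sum_(j < 14) c j 0 *: << g j >>)@_(g i) = c i 0.
  rewrite raddf_sum (bigD1 i) //= big1 => [|j ji].
    by rewrite mcoeffZ mcoeffU eqxx mulr1 addr0.
  by rewrite mcoeffZ mcoeffU (inj_eq g_inj) (negbTE ji) mulr0.
by rewrite -coefE eab coefE.
Qed.

(* Main.v *)
Require Import Defs.
From mathcomp Require Import all_boot all_order all_algebra zify ring.
From mathcomp.multinomials Require Import monalg.

(* Since T_n is T_{n-1} stacked on top of T, the j-th column of the transfer  *)
(* matrix consists of the coefficients of sum_i a_i <g_j g_i>, so everything  *)
(* reduces to the bilinearity of stacking.  Linearity in the upper factor     *)
(* holds because the bracket of what follows depends on a trace only through  *)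
(* its pairing and number of loops, up to relabelling.  For the lower factor, *)
(* g_j is written as a product of Temperley-Lieb generators acting on the top *)
(* endpoints of a trace; these actions commute, up to relabelling, with the   *)
(* slices read off at the bottom.  The 196 products g_j g_i are computed.     *)

Set Implicit Arguments.
Unset Strict Implicit.
Unset Printing Implicit Defensive.

Import GRing.Theory.
Local Open Scope ring_scope.

(** Each stack $g_jg_i$ is $x^l g_k$ for a single pair $(k,l)$. If stacking is bilinear for
    brackets, the coefficient of $g_k$ in $\langle T_{n-1}T\rangle$ is $\sum_j a_j^{(n-1)}\sum_i a_i
    x^l$, the inner sum running over the $i$ with $g_jg_i=x^lg_k$. That inner sum is the entry
    $(k,j)$ of the matrix ([transfer_matrixE]).

    Bilinearity is asymmetric here because [bracket_from] reads slices downwards. For the upper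
    factor ([bracket_from_cat]), the trace reached after it may be replaced by a standard diagram
    with some loops. For the lower factor ([bracket_g_trace]), starting below $g_j$ must amount to
    attaching $g_j$ after the reading; this holds because operations on top endpoints and on bottom
    points commute. [bracket_concat] combines the two. *)

Definition labels (t : trace) : seq nat := tops t ++ bots t.

Definition relabel (f : nat -> nat) (t : trace) : trace :=
  Trace (map f (tops t)) (map f (bots t)) (loops t).

(** Only the pattern of equal labels has geometric meaning, so injectivity is asked just on the
    labels that occur. *)
Definition equiv (t t' : trace) : Prop :=
  exists2 f, {in labels t &, injective f} & t' = relabel f t.

Definition merge (p q r : nat) : nat := if r == q then p else r.

(** Turning a trace upside down lets [cup_trace] and [cap_with] act on its top endpoints. *)
Definition flip (t : trace) : trace := Trace (bots t) (tops t) (loops t).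

(** The label is a parameter because the two sides of a commutation may choose different fresh
    labels. *)
Definition cap_with (c i : nat) (t : trace) : trace :=
  Trace (tops t) (take i (bots t) ++ [:: c; c] ++ drop i (bots t)) (loops t).

(* Unlike [fresh], whose \max is locked, this reduces under vm_compute. *)
Definition new_label (t : trace) : nat := (foldr maxn 0 (labels t)).+1.

(* The Temperley-Lieb generator [Cup i; Cap i] stacked on top of a trace.    *)
Definition top_gen (i : nat) (t : trace) : trace :=
  let t1 := cup_trace i (flip t) in flip (cap_with (new_label t1) i t1).

Definition top_act (w : seq nat) (t : trace) : trace := foldr top_gen t w.

(* Each g as a product of Temperley-Lieb generators, read from top to bottom. *)
Definition g_words : seq (seq nat) :=
  [:: [::]; [:: 0]; [:: 1]; [:: 2]; [:: 1; 0]; [:: 0; 1]; [:: 2; 1]; [:: 1; 2];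
      [:: 1; 0; 2]; [:: 1; 0; 2; 1]; [:: 0; 2]; [:: 0; 2; 1]; [:: 2; 1; 0];
      [:: 0; 1; 2]]%N.

Definition g_trace (i : nat) : trace := top_act (nth [::] g_words i) init_trace.

(* [product j i = (k, l)]: g_j stacked on top of g_i is g_k with l closed     *)
(* curves, all indices counted from 0.                                        *)
Definition product (j i : nat) : nat * nat :=
  let t := top_act (nth [::] g_words j) (g_trace i) in
  (find (fun k => canonical (trace_word t) == canonical (trace_word (g_trace k)))
     (iota 0 14), loops t).

(** * Traces up to injective relabelling *)

Lemma flipK : involutive flip. Proof. by case. Qed.

Lemma labels_flip t : labels (flip t) =i labels t.
Proof. by move=> x; rewrite !mem_cat orbC. Qed.

Lemma equiv_refl t : equiv t t.
Proof.
by exists id => //; case: t => s s' l; rewrite /relabel /= !map_id.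
Qed.

Lemma labels_relabel f t : labels (relabel f t) = map f (labels t).
Proof. by rewrite /labels map_cat. Qed.

Lemma equiv_trans t t' t'' : equiv t t' -> equiv t' t'' -> equiv t t''.
Proof.
move=> [f injf ->] [h]; rewrite labels_relabel => injh ->.
exists (h \o f); last by rewrite /relabel /= -!map_comp.
move=> x y xt yt ehf; apply: injf => //; apply: injh; rewrite ?map_f //.
Qed.

Lemma equiv_flip t t' : equiv t t' -> equiv (flip t) (flip t').
Proof.
move=> [f injf ->]; exists f => // x y; rewrite !labels_flip; exact: injf.
Qed.

(** Labellings with the same kernel differ by the well-defined injection [F x] to [G x], computed by
    looking up the first point with a given [F]-label. *)
Lemma equiv_kernel (I : eqType) (x0 : I) (F G : I -> nat) (s s' : seq I) (l : nat) :
  {in s ++ s' &, forall x y, (F x == F y) = (G x == G y)} ->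
  equiv (Trace (map F s) (map F s') l) (Trace (map G s) (map G s') l).
Proof.
move=> FG; set u := s ++ s'; pose f y := G (nth x0 u (index y (map F u))).
have fF x : x \in u -> f (F x) = G x.
  move=> xu; have lti : (index (F x) (map F u) < size u)%N.
    by rewrite -(size_map F) index_mem map_f.
  apply/eqP; rewrite -FG ?mem_nth //.
  by rewrite -(nth_map x0 0%N) // nth_index ?map_f.
exists f.
  rewrite /labels -map_cat => _ _ /mapP[x xu ->] /mapP[y yu ->].
  by rewrite !fF // => /eqP; rewrite -FG // => /eqP.
rewrite /relabel -!map_comp; congr Trace; apply/eq_in_map => x xs /=;
  by rewrite fF // mem_cat xs ?orbT.
Qed.

(** Merging a label with itself is the identity, so closing a loop and joining two arcs share one
    formula. *)
Lemma cup_traceE i t :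
  let p := nth 0%N (bots t) i in let q := nth 0%N (bots t) i.+1 in
  cup_trace i t = Trace (map (merge p q) (tops t))
    (map (merge p q) (take i (bots t) ++ drop i.+2 (bots t)))
    ((p == q) + loops t).
Proof.
move=> p q; rewrite /cup_trace -/p -/q; case: (eqVneq p q) => //= <-.
by congr Trace; rewrite -[LHS]map_id; apply: eq_map => r; rewrite /merge;
  case: eqP.
Qed.

Lemma merge_inj (f : nat -> nat) p q r (s : seq nat) :
  {in s &, injective f} -> q \in s -> r \in s ->
  f (merge p q r) = merge (f p) (f q) (f r).
Proof.
by move=> injf qs rs; rewrite /merge (inj_in_eq injf) //; case: ifP.
Qed.

Lemma mem_take_drop (s : seq nat) (i j : nat) :
  {subset take i s ++ drop j s <= s}.
Proof. by move=> x; rewrite mem_cat => /orP[/mem_take|/mem_drop]. Qed.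

Lemma labels_cup i t :
  (i.+1 < size (bots t))%N -> {subset labels (cup_trace i t) <= labels t}.
Proof.
move=> lti x; rewrite cup_traceE /labels -map_cat => /mapP[y + ->].
rewrite /merge; case: eqP => _ yt.
  by rewrite mem_cat mem_nth ?orbT // ltnW.
by move: yt; rewrite mem_cat => /orP[yt|/mem_take_drop yt]; rewrite mem_cat yt ?orbT.
Qed.

Lemma cup_relabel f i t :
  (i.+1 < size (bots t))%N -> {in labels t &, injective f} ->
  cup_trace i (relabel f t) = relabel f (cup_trace i t).
Proof.
move=> lti injf; rewrite !cup_traceE /relabel /= !(nth_map 0%N) ?(ltnW lti) //.
have inb x : x \in bots t -> x \in labels t.
  by move=> xb; rewrite mem_cat xb orbT.
have inn j : (j < size (bots t))%N -> nth 0%N (bots t) j \in labels t.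
  by move=> ltj; apply/inb/mem_nth.
rewrite (inj_in_eq injf) ?inn ?(ltnW lti) // -map_take -map_drop -map_cat.
congr Trace; rewrite -!map_comp; apply/eq_in_map => x xs /=;
  rewrite (merge_inj _ injf) ?inn //.
  by rewrite mem_cat xs.
exact/inb/(mem_take_drop xs).
Qed.

Lemma equiv_cup i t t' :
  (i.+1 < size (bots t))%N -> equiv t t' -> equiv (cup_trace i t) (cup_trace i t').
Proof.
move=> lti [f injf ->]; exists f; last exact: cup_relabel.
by move=> x y /(labels_cup lti) xt /(labels_cup lti) yt; apply: injf.
Qed.

Lemma mem_labels_cap c i t x :
  (x \in labels (cap_with c i t)) = (x == c) || (x \in labels t).
Proof.
rewrite /labels /cap_with /= -[in RHS](cat_take_drop i (bots t)) !mem_cat !inE.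
by do 3?[case: (_ \in _) => //=]; case: (x == c).
Qed.

(** The relabelling extends by sending [c] to [c']; as neither label is in use, it stays
    injective. *)
Lemma equiv_cap c c' i t t' :
  c \notin labels t -> c' \notin labels t' -> equiv t t' ->
  equiv (cap_with c i t) (cap_with c' i t').
Proof.
move=> cN c'N [f injf et]; subst t'.
pose h x := if x == c then c' else f x.
have hc : h c = c' by rewrite /h eqxx.
have hf x : x \in labels t -> h x = f x.
  by rewrite /h; case: eqP => // ->; rewrite (negbTE cN).
have hfs s : {subset s <= labels t} -> map h s = map f s.
  by move=> ss; apply/eq_in_map => x /ss; apply: hf.
exists h.
  have fN x : x \in labels t -> c' != f x.
    by move=> xt; apply: contraNneq c'N => ->; rewrite labels_relabel map_f.
  move=> x y; rewrite !mem_labels_cap.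
  case/predU1P=> [->|xt] /predU1P[->|yt] //; rewrite ?hc ?hf //.
  - by move/eqP; rewrite (negbTE (fN _ yt)).
  - by move/eqP; rewrite eq_sym (negbTE (fN _ xt)).
  - exact: injf.
rewrite /cap_with /relabel /= !map_cat /= hc map_take map_drop.
congr Trace; first by rewrite hfs // => x xt; rewrite mem_cat xt.
by rewrite (hfs (bots t)) // => x xt; rewrite mem_cat xt orbT.
Qed.

Lemma fresh_notin t : fresh t \notin labels t.
Proof.
apply/negP=> ft.
by have := @leq_bigmax_seq _ _ predT id _ ft isT; rewrite ltnn.
Qed.

Lemma new_label_notin t : new_label t \notin labels t.
Proof.
rewrite /new_label; suff lt x s : x \in s -> (x <= foldr maxn 0 s)%N.
  by apply/negP => /lt; rewrite ltnn.
elim: s => //= y s IH; rewrite inE => /predU1P[->|/IH]; rewrite leq_max ?leqnn //.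
by move=> ->; rewrite orbT.
Qed.

Lemma cap_traceE i t : cap_trace i t = cap_with (fresh t) i t.
Proof. by []. Qed.

Lemma equiv_cap_trace i t t' :
  equiv t t' -> equiv (cap_trace i t) (cap_trace i t').
Proof. by move=> e; rewrite !cap_traceE; apply: equiv_cap; rewrite ?fresh_notin. Qed.

Lemma merge_eq p q x y :
  (merge p q x == merge p q y) =
  (x == y) || (x \in [:: p; q]) && (y \in [:: p; q]).
Proof.
rewrite /merge !inE; case: (x =P q) => [->|xq]; case: (y =P q) => [->|yq];
  rewrite ?eqxx ?orbT ?orbF ?andbT //=.
- by case: (q =P y) => [/esym//|_] /=; rewrite eq_sym.
- by case: (x =P q).
- by case: (x =P y) => //= xy; apply/esym/andP => -[/eqP ex /eqP ey]; case: xy;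
    rewrite ex ey.
Qed.

Lemma merge_factor (N : nat -> nat) p q x :
  N p = N q -> N (merge p q x) = N x.
Proof. by move=> e; rewrite /merge; case: eqP => // ->. Qed.

(* A function N with N p = N q and N p' = N q' is unchanged by composing it   *)
(* with either merge, so the composite of the merges in one order factors     *)
(* through their composite in the other order.                                *)
Lemma merge_merge p q p' q' x y :
  merge (merge p' q' p) (merge p' q' q) (merge p' q' x) =
    merge (merge p' q' p) (merge p' q' q) (merge p' q' y) ->
  merge (merge p q p') (merge p q q') (merge p q x) =
    merge (merge p q p') (merge p q q') (merge p q y).
Proof.
pose N z := merge (merge p q p') (merge p q q') (merge p q z).
have mE a b : merge a b a = merge a b b by rewrite /merge eqxx; case: eqP.
have Np : N p = N q by rewrite /N mE.
have Np' : N p' = N q' by rewrite /N mE.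
have Nf z : N (merge p' q' z) = N z := merge_factor z Np'.
have Nff z : N (merge (merge p' q' p) (merge p' q' q) z) = N z.
  by apply: merge_factor; rewrite !Nf.
by move/(congr1 N); rewrite !Nff !Nf.
Qed.

(** View labels as vertices and the two cups as edges: each side counts the edges closing a cycle,
    which is the number of edges minus the rank and hence independent of the order. *)
Lemma merge_rank p q p' q' :
  ((p' == q') + (merge p' q' p == merge p' q' q) =
   (p == q) + (merge p q p' == merge p q q'))%N.
Proof.
have no a b c : a <> b -> (a == c) && (b == c) = false.
  by move=> ab; apply/andP => -[/eqP ac /eqP bc]; case: ab; rewrite ac.
rewrite !merge_eq !inE; case: (p =P q) => [->|pq]; case: (p' =P q') => [->|pq'] //=.
- by rewrite !orbb no.
- by rewrite !orbb no.
congr nat_of_bool; apply/andP/andP => -[/orP[]/eqP a /orP[]/eqP b]; subst;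
  by rewrite ?eqxx ?orbT.
Qed.

(** Only an equivalence: which label survives depends on the order of the merges. *)
Lemma cup_cup_flip i j t :
  (i.+1 < size (tops t))%N -> (j.+1 < size (bots t))%N ->
  equiv (cup_trace j (flip (cup_trace i (flip t))))
        (flip (cup_trace i (flip (cup_trace j t)))).
Proof.
move=> lti ltj; have [ltj' lti'] := (ltnW ltj, ltnW lti).
have nth_merge s p q k : (k < size s)%N ->
    nth 0%N (map (merge p q) s) k = merge p q (nth 0%N s k).
  exact: nth_map.
rewrite !cup_traceE /flip /= !nth_merge //.
move: (nth _ (tops t) i) (nth _ (tops t) i.+1) => p' q'.
move: (nth _ (bots t) j) (nth _ (bots t) j.+1) => p q.
rewrite -!map_take -!map_drop -!map_cat -!map_comp !addnA.
rewrite [(_ + (p' == q'))%N]addnC merge_rank [((p == q) + _)%N]addnC.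
by apply: (equiv_kernel 0%N) => x y _ _ /=; apply/eqP/eqP; apply: merge_merge.
Qed.

Lemma size_tops_cup i t : size (tops (cup_trace i t)) = size (tops t).
Proof. by rewrite cup_traceE /= size_map. Qed.

Lemma size_cap_with c i t :
  (i <= size (bots t))%N -> size (bots (cap_with c i t)) = (size (bots t)).+2.
Proof.
by move=> lei; rewrite -(size_cap lei) /= !size_cat.
Qed.

Lemma cup_cap_flip c i j t :
  c \notin labels t -> (j.+1 < size (bots t))%N ->
  cup_trace j (flip (cap_with c i (flip t))) =
  flip (cap_with c i (flip (cup_trace j t))).
Proof.
move=> cN ltj; rewrite !cup_traceE /flip /cap_with /= !map_cat /=.
have -> : merge (nth 0%N (bots t) j) (nth 0%N (bots t) j.+1) c = c.
  rewrite /merge; case: eqP => // ec; case/negP: cN.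
  by rewrite ec mem_cat mem_nth // orbT.
by rewrite !map_take !map_drop.
Qed.

Lemma top_gen_split i t : exists2 c, c \notin labels (flip (cup_trace i (flip t))) &
  top_gen i t = flip (cap_with c i (cup_trace i (flip t))).
Proof.
by exists (new_label (cup_trace i (flip t))); rewrite ?labels_flip ?new_label_notin.
Qed.

Lemma size_tops_top_gen i t :
  (i.+1 < size (tops t))%N -> size (tops (top_gen i t)) = size (tops t).
Proof.
move=> lti; rewrite /top_gen [tops _]/= size_cap_with size_cup //=.
all: by rewrite [size _]/= in lti *; lia.
Qed.

Lemma size_bots_top_gen i t : size (bots (top_gen i t)) = size (bots t).
Proof. exact: (size_tops_cup i (flip t)). Qed.

Lemma equiv_top_gen i t t' :
  (i.+1 < size (tops t))%N -> equiv t t' -> equiv (top_gen i t) (top_gen i t').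
Proof.
move=> lti e; apply/equiv_flip/equiv_cap; rewrite ?new_label_notin //.
exact/equiv_cup/equiv_flip.
Qed.

Lemma top_gen_cup i j t :
  (i.+1 < size (tops t))%N -> (j.+1 < size (bots t))%N ->
  equiv (cup_trace j (top_gen i t)) (top_gen i (cup_trace j t)).
Proof.
move=> lti ltj; have [c cN ->] := top_gen_split i t.
have ltj' : (j.+1 < size (bots (flip (cup_trace i (flip t)))))%N.
  by rewrite size_tops_cup.
rewrite -[cup_trace i _]flipK cup_cap_flip //; apply/equiv_flip/equiv_cap.
- by rewrite labels_flip; apply: contra cN; apply: labels_cup.
- exact: new_label_notin.
by rewrite -[X in equiv _ X]flipK; apply/equiv_flip/cup_cup_flip.
Qed.

Lemma top_gen_cap i j t :
  (i.+1 < size (tops t))%N ->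
  equiv (cap_trace j (top_gen i t)) (top_gen i (cap_trace j t)).
Proof.
move=> lti; rewrite !cap_traceE; set d := fresh _; set d' := fresh _.
have := fresh_notin (top_gen i t); rewrite -/d.
have [c cN ->] := top_gen_split i t; rewrite labels_flip mem_labels_cap negb_or.
case/andP=> dc dN; set t2 := flip (cup_trace i (flip t)) in cN.
have d'N : d' \notin labels t2.
  apply: contra (fresh_notin t); rewrite labels_flip => /labels_cup.
  by rewrite labels_flip; apply.
(* With labels fixed, the two caps act on different lists and commute by computation. *)
apply: (@equiv_trans _ (flip (cap_with c i (flip (cap_with d j t2))))).
  exact: equiv_refl.
apply/equiv_flip/equiv_cap.
- by rewrite labels_flip mem_labels_cap negb_or eq_sym dc.
- exact: new_label_notin.
have -> : cup_trace i (flip (cap_with d' j t)) = flip (cap_with d' j t2).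
  by rewrite -[t in LHS]flipK cup_cap_flip ?labels_flip ?fresh_notin.
by apply/equiv_flip/equiv_cap/equiv_refl; rewrite // -labels_flip.
Qed.

Definition top_word (m : nat) (w : seq nat) := all (fun i => (i.+1 < m)%N) w.

Lemma size_top_act w t : top_word (size (tops t)) w ->
  size (tops (top_act w t)) = size (tops t) /\
  size (bots (top_act w t)) = size (bots t).
Proof.
elim: w => //= i w IH /andP[lti /IH[szt szb]].
by rewrite size_bots_top_gen size_tops_top_gen szt.
Qed.

Lemma equiv_top_act w t t' : top_word (size (tops t)) w ->
  equiv t t' -> equiv (top_act w t) (top_act w t').
Proof.
move=> + e; elim: w => //= i w IH /andP[lti wfw]; apply: equiv_top_gen (IH wfw).
by rewrite (size_top_act wfw).1.
Qed.

Lemma top_act_cup w j t :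
  top_word (size (tops t)) w -> (j.+1 < size (bots t))%N ->
  equiv (cup_trace j (top_act w t)) (top_act w (cup_trace j t)).
Proof.
move=> + ltj; elim: w => [_|i w IH /= /andP[lti wfw]]; first exact: equiv_refl.
have [szt szb] := size_top_act wfw.
apply: equiv_trans (top_gen_cup _ _) _; rewrite ?szt ?szb //.
by apply: equiv_top_gen (IH wfw); rewrite size_tops_cup szt.
Qed.

Lemma top_act_cap w j t : top_word (size (tops t)) w ->
  equiv (cap_trace j (top_act w t)) (top_act w (cap_trace j t)).
Proof.
elim: w => [_|i w IH /= /andP[lti wfw]]; first exact: equiv_refl.
have [szt szb] := size_top_act wfw.
apply: equiv_trans (top_gen_cap _ _) _; rewrite ?szt //.
by apply: equiv_top_gen (IH wfw); rewrite /= szt.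
Qed.

(** * The bracket depends only on the pairing and the loops *)

Definition add_loops (l : nat) (t : trace) : trace :=
  Trace (tops t) (bots t) (loops t + l).

Lemma top_act_add_loops w l t :
  top_act w (add_loops l t) = add_loops l (top_act w t).
Proof.
elim: w => //= i w ->; rewrite /top_gen !cup_traceE /flip /add_loops /=.
by rewrite /cap_with /= addnA.
Qed.

Lemma bracket_add_loops l t w :
  bracket_from (add_loops l t) w = 'X^l *: bracket_from t w.
Proof.
elim: l => [|l IH]; first by rewrite scale1r /add_loops addn0; case: t.
by rewrite exprS -scalerA -IH -bracket_from_loop /add_loops addnS.
Qed.

Lemma label_pairingE t e f :
  (label t e == label t f) =
  [exists B in trace_pairing t, (e \in B) && (f \in B)].
Proof.
apply/idP/exists_inP => [ef|[_ /imsetP[h _ ->]]].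
  exists [set y in [set: endpoint] | label t e == label t y].
    by apply/imsetP; exists e.
  by rewrite !inE eqxx.
by rewrite !inE => /andP[/eqP <- /eqP <-].
Qed.

Lemma trace_pairing_kernel t t' :
  (forall e f, (label t e == label t f) = (label t' e == label t' f)) ->
  trace_pairing t = trace_pairing t'.
Proof.
by move=> tt'; apply: eq_imset => e; apply/setP => f; rewrite !inE /= tt'.
Qed.

Lemma label_map t : size (tops t) = 4%N -> size (bots t) = 4%N ->
  t = Trace (map (label t) (map inl (enum 'I_4)))
        (map (label t) (map inr (enum 'I_4))) (loops t).
Proof.
have mkE (h : nat -> nat) : mkseq h 4 = map (fun i : 'I_4 => h i) (enum 'I_4).
  by rewrite /mkseq -val_enum_ord -map_comp.
case: t => a b l /= sza szb; congr Trace.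
  by rewrite -[LHS](mkseq_nth 0%N) sza mkE -[RHS]map_comp.
by rewrite -[LHS](mkseq_nth 0%N) szb mkE -[RHS]map_comp.
Qed.

(** The blocks of the pairing are the classes of equally labelled endpoints, so the pairing
    determines the kernel of [label] and [equiv_kernel] applies. *)
Lemma pairing_equiv t t' :
  size (tops t) = 4%N -> size (bots t) = 4%N ->
  size (tops t') = 4%N -> size (bots t') = 4%N -> loops t = loops t' ->
  trace_pairing t = trace_pairing t' -> equiv t t'.
Proof.
move=> szt szb szt' szb' el ep; rewrite (label_map szt szb) (label_map szt' szb').
rewrite -el; apply: (equiv_kernel (top 1)) => e f _ _.
by rewrite !label_pairingE ep.
Qed.

Lemma mem_label t e :
  size (tops t) = 4%N -> size (bots t) = 4%N -> label t e \in labels t.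
Proof.
by move=> szt szb; rewrite mem_cat; case: e => i /=;
  rewrite mem_nth ?orbT ?szt ?szb.
Qed.

Lemma equiv_pairing t t' :
  size (tops t) = 4%N -> size (bots t) = 4%N -> equiv t t' ->
  trace_pairing t = trace_pairing t'.
Proof.
move=> szt szb [h injh ->]; apply: trace_pairing_kernel => e f.
have lab x : label (relabel h t) x = h (label t x).
  by case: x => i /=; rewrite (nth_map 0%N) ?szt ?szb.
by rewrite !lab (inj_in_eq injh) ?mem_label.
Qed.

Lemma bracket_from_equiv t t' w :
  size (tops t) = 4%N -> well_formed (size (bots t)) 4 w -> equiv t t' ->
  bracket_from t w = bracket_from t' w.
Proof.
elim: w t t' => [|[i|i|i] w IH] t t' szt /=.
- by move=> /eqP szb e; rewrite (equiv_pairing szt szb e); case: e => f _ ->.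
- by case/andP=> lti wfw /(equiv_cup lti); apply: IH;
    rewrite ?size_tops_cup ?size_cup.
- by case/andP=> lti wfw /(equiv_cap_trace i); apply: IH; rewrite ?size_cap.
- case/andP=> lti wfw e; rewrite (IH _ _ szt wfw e); congr (_ + _).
  apply: IH (equiv_cap_trace i (equiv_cup lti e)).
    by rewrite /= size_tops_cup.
  by rewrite size_cap size_cup //; [have -> : (size (bots t) - 2).+2 =
      size (bots t) by lia | lia].
Qed.

Definition good (t : trace) : Prop :=
  size (tops t) = 4%N /\ noncrossing (trace_word t).

Lemma good_init : good init_trace.
Proof.
split=> //; apply: (@noncrossing_ins [:: 3; 2; 1]%N) => //.
apply: (@noncrossing_ins [:: 3; 2]%N) => //.
apply: (@noncrossing_ins [:: 3]%N) => //.
exact: (@noncrossing_ins [::] [::] 3 _ noncrossing_nil).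
Qed.

Lemma good_cup i t : (i.+1 < size (bots t))%N -> good t -> good (cup_trace i t).
Proof.
by move=> lti [szt nct]; split; rewrite ?size_tops_cup //; apply: noncrossing_cup.
Qed.

Lemma good_cap i t : good t -> good (cap_trace i t).
Proof. by case=> szt nct; split=> //; apply: noncrossing_cap. Qed.

(** * Linear extension from the 14 basis diagrams *)

Notation bracket_module := {malg {poly int}[pairing]}.

(** The slice recursion and its final values determine [bracket_from]. Both linearity statements are
    instances, with [L] a [basis_comb]. *)
Lemma bracket_from_ext (L : bracket_module -> bracket_module)
    (H : trace -> seq slice -> bracket_module) :
  {morph L : x y / x + y} ->
  (forall t i w, good t -> well_formed (size (bots t)) 4 (Cup i :: w) ->
     H t (Cup i :: w) = H (cup_trace i t) w) ->
  (forall t i w, good t -> well_formed (size (bots t)) 4 (Cap i :: w) ->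
     H t (Cap i :: w) = H (cap_trace i t) w) ->
  (forall t i w, good t -> well_formed (size (bots t)) 4 (Cross i :: w) ->
     H t (Cross i :: w) = H t w + H (cap_trace i (cup_trace i t)) w) ->
  (forall t, good t -> size (bots t) = 4%N ->
     H t [::] = L ('X^(loops t) *: << trace_pairing t >>)) ->
  forall t w, good t -> well_formed (size (bots t)) 4 w ->
    H t w = L (bracket_from t w).
Proof.
move=> LD Hcup Hcap Hcross H0 t w; elim: w t => [|[i|i|i] w IH] t gt wf.
- by apply: H0 => //; apply/eqP.
- rewrite Hcup //; case/andP: wf => lti wf.
  by apply: IH; rewrite ?size_cup //; apply: good_cup.
- rewrite Hcap //; case/andP: wf => lei wf.
  by apply: IH; rewrite ?size_cap //; apply: good_cap.
- rewrite Hcross //; case/andP: wf => lti wf.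
  rewrite /= LD IH //; congr (_ + _); apply: IH.
    exact/good_cap/good_cup.
  by rewrite size_cap size_cup //; [have -> : (size (bots t) - 2).+2 =
      size (bots t) by lia | lia].
Qed.

(** The linear map sending the basis element of [g i] to [F i] and that of any other pairing to
    0. *)
Definition basis_comb (F : 'I_14 -> bracket_module) (m : bracket_module) :=
  \sum_(i < 14) m@_(g i) *: F i.

Lemma basis_combD F : {morph basis_comb F : x y / x + y}.
Proof.
move=> x y; rewrite -big_split /=; apply: eq_bigr => i _.
by rewrite mcoeffD scalerDl.
Qed.

Lemma basis_combZ F c i : basis_comb F (c *: << g i >>) = c *: F i.
Proof.
rewrite /basis_comb (bigD1 i) //= big1 => [|j ji].
  by rewrite mcoeffZ mcoeffU eqxx mulr1 addr0.
by rewrite mcoeffZ mcoeffU (inj_eq g_inj) eq_sym (negbTE ji) mulr0 scale0r.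
Qed.

Lemma mcoeff_basis_comb F m k :
  (basis_comb F m)@_k = \sum_(i < 14) m@_(g i) * (F i)@_k.
Proof. by rewrite raddf_sum; apply: eq_bigr => i _ /=; rewrite mcoeffZ. Qed.

Lemma coeff_basis (c : 'cV[{poly int}]_14) i :
  (\sum_(j < 14) c j 0 *: << g j >> : bracket_module)@_(g i) = c i 0.
Proof.
rewrite raddf_sum (bigD1 i) //= big1 => [|j ji].
  by rewrite mcoeffZ mcoeffU eqxx mulr1 addr0.
by rewrite mcoeffZ mcoeffU (inj_eq g_inj) (negbTE ji) mulr0.
Qed.

(** * Computation of the basis diagrams and their products *)

Lemma canonical_label t e f :
  size (tops t) = 4%N -> size (trace_word t) = 8%N ->
  (nth 0%N (canonical (trace_word t)) (position e) ==
   nth 0%N (canonical (trace_word t)) (position f)) = (label t e == label t f).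
Proof.
by move=> szt szw; rewrite canonical_eq ?szw ?position_lt // !label_position.
Qed.

(** Soundness of the boolean test [matches], so that pairings, being sets, never have to be
    evaluated. *)
Lemma pairing_of_matches t (l : seq (endpoint * endpoint)) :
  size (tops t) = 4%N -> size (trace_word t) = 8%N ->
  matches (canonical (trace_word t)) (map position2 l) ->
  trace_pairing t = pairing_of l.
Proof.
move=> szt szw; have labE e f := canonical_label e f szt szw.
case/and3P; rewrite !all_map => /allP eql /allP uniql /allP covl.
have block x p : p \in l -> (x == p.1) || (x == p.2) ->
    [set y in [set: endpoint] | label t x == label t y] = [set p.1; p.2].
  move=> pl xp; have {xp} lx : label t x = label t p.1.
    have := eql p pl; rewrite /= labE => /eqP ep.
    by case/orP: xp => /eqP ->.
  apply/setP => y; rewrite !inE lx /=; apply/idP/orP => [lpy|]; last first.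
    by have := eql p pl; rewrite /= labE => ep; case=> /eqP ->.
  have := covl (position y); rewrite mem_iota position_lt => /(_ isT).
  rewrite has_map => /hasP[q ql] /=; rewrite !(inj_eq position_inj) => qy.
  have lq : label t y = label t q.1.
    have := eql q ql; rewrite /= labE => /eqP eq.
    by case/orP: qy => /eqP <-.
  have /= := uniql p pl; rewrite all_map => /allP /(_ q ql) /=.
  rewrite labE -lq lpy /= => /eqP[/position_inj -> /position_inj ->].
  by rewrite ![y == _]eq_sym; apply/orP.
apply/setP => B; apply/imsetP/imsetP => [[x _ ->]|[p pl ->]].
  have := covl (position x); rewrite mem_iota position_lt => /(_ isT).
  rewrite has_map => /hasP[p pl] /=; rewrite !(inj_eq position_inj) => px.
  by exists p => //; apply: block => //; rewrite ![x == _]eq_sym.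
by exists p.1; rewrite ?inE // (block _ p) ?eqxx.
Qed.

Lemma canonical_pairing t t' :
  size (tops t) = 4%N -> size (trace_word t) = 8%N ->
  size (tops t') = 4%N -> size (trace_word t') = 8%N ->
  canonical (trace_word t) = canonical (trace_word t') ->
  trace_pairing t = trace_pairing t'.
Proof.
move=> szt szw szt' szw' ec; apply: trace_pairing_kernel => e f.
by rewrite -canonical_label // ec canonical_label.
Qed.

Lemma g_trace_spec (i : 'I_14) :
  [/\ size (tops (g_trace i)) = 4%N, size (bots (g_trace i)) = 4%N,
      loops (g_trace i) = 0%N & trace_pairing (g_trace i) = g i].
Proof.
have : all (fun i => let t := g_trace i in [&& size (tops t) == 4,
    size (bots t) == 4, loops t == 0%N &
    matches (canonical (trace_word t)) (nth [::] g_positions i)]) (iota 0 14).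
  by vm_compute.
move/allP/(_ i); rewrite mem_iota ltn_ord => /(_ isT).
case/and4P=> /eqP szt /eqP szb /eqP l0; rewrite -g_positionsE (nth_map [::]) //.
move=> m; split=> //; apply: pairing_of_matches m => //.
by rewrite size_cat size_rev szt szb.
Qed.

Lemma g_words_top_word (i : 'I_14) : top_word 4 (nth [::] g_words i).
Proof.
have : all (top_word 4) g_words by [].
by move/all_nthP; apply; rewrite ltn_ord.
Qed.

Lemma productP (j i : 'I_14) :
  let t := top_act (nth [::] g_words j) (g_trace i) in
  exists2 k : 'I_14, (product j i).1 = k & trace_pairing t = g k.
Proof.
(* The bound excludes 14, the value of [find] when nothing is found. *)
have : all (fun j => all (fun i =>
    let t := top_act (nth [::] g_words j) (g_trace i) in
    ((product j i).1 < 14)%N && (canonical (trace_word t) ==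
      canonical (trace_word (g_trace (product j i).1)))) (iota 0 14)) (iota 0 14).
  by vm_compute.
move/allP/(_ j); rewrite mem_iota ltn_ord => /(_ isT).
move/allP/(_ i); rewrite mem_iota ltn_ord => /(_ isT) /andP[ltk /eqP ec] t.
exists (Ordinal ltk) => //.
have [szt szb _ _] := g_trace_spec i.
have [szt' szb' _ <-] := g_trace_spec (Ordinal ltk).
have [] := @size_top_act (nth [::] g_words j) (g_trace i).
  by rewrite szt g_words_top_word.
rewrite -/t szt szb => sz1 sz2.
by apply: canonical_pairing; rewrite ?size_cat ?size_rev ?szt' ?szb' ?sz1 ?sz2.
Qed.

(** * Bilinearity of stacking *)

Lemma good_basis t : good t -> size (bots t) = 4%N ->
  exists2 i : 'I_14, trace_pairing t = g i &
    equiv t (add_loops (loops t) (g_trace i)).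
Proof.
move=> [szt nct] szb; have [i ei] := trace_pairing_g szt szb nct.
have [szt' szb' l0 ei'] := g_trace_spec i; exists i => //.
apply: pairing_equiv; rewrite //= ?l0 // ei.
exact: esym ei'.
Qed.

Lemma bracket_from_cat t u w :
  good t -> well_formed (size (bots t)) 4 u -> well_formed 4 4 w ->
  bracket_from t (u ++ w) =
  basis_comb (fun j => bracket_from (g_trace j) w) (bracket_from t u).
Proof.
move=> gt wfu wfw.
apply: (@bracket_from_ext _ (fun t u => bracket_from t (u ++ w))) gt wfu => //.
  exact: basis_combD.
move=> {}t gt szb; have [i ei /bracket_from_equiv e] := good_basis gt szb.
rewrite ei basis_combZ /= e ?szb //; last by case: gt.
by rewrite bracket_add_loops.
Qed.

Definition product_bracket (j i : nat) : bracket_module :=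
  'X^((product j i).2) *: << g (inord (product j i).1) >>.

(** The action of $g_j$ on top commutes with every slice up to [equiv], so it can be postponed to
    the end of [w], where it is a product of two basis diagrams times loops. *)
Lemma bracket_g_trace (j : 'I_14) t w :
  good t -> well_formed (size (bots t)) 4 w ->
  bracket_from (top_act (nth [::] g_words j) t) w =
  basis_comb (product_bracket j) (bracket_from t w).
Proof.
set v := nth _ _ _; have wv t' : good t' -> top_word (size (tops t')) v.
  by case=> -> _; apply: g_words_top_word.
move: t w; apply: (@bracket_from_ext _ (fun t w => bracket_from (top_act v t) w)).
- exact: basis_combD.
- move=> t i w gt /= /andP[lti wf]; have [szt szb] := size_top_act (wv _ gt).
  apply: bracket_from_equiv (top_act_cup (wv _ gt) lti).
    by rewrite size_tops_cup szt; case: gt.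
  by rewrite size_cup szb.
- move=> t i w gt /= /andP[lti wf]; have [szt szb] := size_top_act (wv _ gt).
  apply: bracket_from_equiv (top_act_cap i (wv _ gt)).
    by rewrite /= szt; case: gt.
  by rewrite size_cap szb.
- move=> t i w gt /= /andP[lti wf]; have [szt szb] := size_top_act (wv _ gt).
  congr (_ + _); set t1 := cup_trace i t; have gt1 : good t1 by apply: good_cup.
  have e : equiv (cap_trace i (cup_trace i (top_act v t)))
                 (top_act v (cap_trace i t1)).
    apply: equiv_trans (top_act_cap i (wv _ gt1)); apply: equiv_cap_trace.
    exact: top_act_cup (wv _ gt) lti.
  apply: bracket_from_equiv e; first by rewrite /= size_tops_cup szt; case: gt.
  by rewrite size_cap size_cup szb //; [have -> : (size (bots t) - 2).+2 =
      size (bots t) by lia | lia].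
- move=> t gt szb; have [i ei e] := good_basis gt szb.
  have [szt' szb'] := size_top_act (wv _ gt).
  have -> : bracket_from (top_act v t) [::] =
      bracket_from (top_act v (add_loops (loops t) (g_trace i))) [::].
    apply: bracket_from_equiv (equiv_top_act (wv _ gt) e).
      by rewrite szt'; case: gt.
    by rewrite szb' szb.
  rewrite ei basis_combZ.
  rewrite top_act_add_loops bracket_add_loops.
  suff -> : bracket_from (top_act v (g_trace i)) [::] = product_bracket j i by [].
  have [k ek ep] := productP j i.
  by rewrite /product_bracket ek inord_val -ep.
Qed.

Lemma bracket_concat (u w : seq slice) (k : 'I_14) :
  well_formed 4 4 u -> well_formed 4 4 w ->
  (bracket_from init_trace (u ++ w))@_(g k) =
  \sum_(j < 14) \sum_(i < 14)
    (bracket_from init_trace w)@_(g i) * 'X^((product j i).2) *+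
      ((product j i).1 == k) * (bracket_from init_trace u)@_(g j).
Proof.
move=> wfu wfw; rewrite bracket_from_cat //; last exact: good_init.
rewrite mcoeff_basis_comb; apply: eq_bigr => j _; rewrite mulrC.
rewrite bracket_g_trace //; last exact: good_init.
rewrite mcoeff_basis_comb mulr_suml; apply: eq_bigr => i _.
rewrite mcoeffZ mcoeffU (inj_eq g_inj); have [k' -> _] := productP j i.
rewrite inord_val (inj_eq val_inj); case: eqP => _.
  by rewrite mulr1n mulr1.
by rewrite mulr0n !mulr0.
Qed.

(** [tangle_pow] adds the new copy above, whereas the columns of the matrix need it below $T_{n-1}$;
    associativity of concatenation exchanges the two. *)
Lemma tangle_powS T n :
  slices (tangle_pow T n.+1) = slices (tangle_pow T n) ++ slices T.
Proof.
elim: n => [|n IH]; first by rewrite /= cats0.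
by rewrite /= in IH *; rewrite {1}IH catA.
Qed.

(** * Comparison with the explicit matrix *)

Definition factors (k j : nat) : seq (nat * nat) :=
  [seq (i, (product j i).2) | i <- iota 0 14 & (product j i).1 == k].

Lemma transfer_rowsE (b : nat -> {poly int}) (k j : nat) :
  (k < 14)%N -> (j < 14)%N ->
  nth 0 (nth [::] (transfer_rows b) k) j =
  \sum_(p <- factors k j) b p.1.+1 * 'X^(p.2).
Proof.
do 14?[case: k => [|k] //]; move=> _;
  do 14?[case: j => [|j] //]; move=> _;
  (* Naming the list confines evaluation to the combinatorial table and leaves the polynomials to
     [ring]. *)
  rewrite /transfer_rows [LHS]/=; set l := factors _ _; vm_compute in (value of l);
  rewrite /l ?big_cons big_nil; ring.
Qed.

Lemma transfer_matrixE (a : 'cV[{poly int}]_14) (k j : 'I_14) :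
  transfer_matrix a k j =
  \sum_(i < 14) a i 0 * 'X^((product j i).2) *+ ((product j i).1 == k).
Proof.
rewrite mxE transfer_rowsE // big_map big_filter big_mkcond.
rewrite -[iota 0 14]val_enum_ord big_map big_enum.
(* Coefficients are numbered from 1 in [transfer_rows] and from 0 in [a]; the two shifts cancel. *)
by apply: eq_bigr => i _; rewrite [_.1.+1.-1]/= inord_val; case: eqP.
Qed.

Theorem lemma3 (T : tangle4) (a : 'cV[{poly int}]_14)
    (A : nat -> 'cV[{poly int}]_14)
    (ha : bracket T = \sum_(i < 14) a i 0 *: << g i >>)
    (hA : forall n : nat,
      bracket (tangle_pow T n) = \sum_(i < 14) A n i 0 *: << g i >>)
    (n : nat) (hn : (1 <= n)%N) :
  A n = transfer_matrix a *m A n.-1.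
Proof.
case: n hn => // n _; apply/colP => k; rewrite mxE -(coeff_basis (A n.+1)) -hA.
rewrite /bracket tangle_powS bracket_concat ?slicesP //.
apply: eq_bigr => j _; rewrite transfer_matrixE mulr_suml.
apply: eq_bigr => i _.
by rewrite -/(bracket T) -/(bracket (tangle_pow T n)) ha hA !coeff_basis.
Qed.
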